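(* Let $\Sigma$ be a complete fan in $\mathbb{R}^n$, $\phi$ a strictly concave rational PL function on $\Sigma$, and $r\in\mathbb{N}^+$ such that $r\phi$ is integral, and assume that $0\in\operatorname{int}(P_{r\phi})$. Then the Lagrangian torus $\mu_{r\phi}^{-1}(0)\subset(\mathbb{C}^\times)^n$ is exact with respect to $\theta_{r\phi}$, i.e. the restriction of $\theta_{r\phi}$ to $\mu_{r\phi}^{-1}(0)$ is an exact one-form.
   Context: Let $n\ge 1$. A complete fan $\Sigma$ in $\mathbb{R}^n$ is a finite collection of strongly convex rational polyhedral cones, closed under taking faces and intersections (two cones meet along a common face), whose union is $\mathbb{R}^n$. $\Sigma(k)$ is the set of $k$-dimensional cones; for a ray $\rho\in\Sigma(1)$, $u_\rho\in\mathbb{Z}^n$ is its primitive generator. A PL function on $\Sigma$ is a continuous $\phi:\mathbb{R}^n\to\mathbb{R}$ linear on each cone; for $\sigma\in\Sigma(n)$ write $\phi|_\sigma=\langle m_\sigma,\cdot\rangle$. It is rational (resp. integral) if all $m_\sigma\in\mathbb{Q}^n$ (resp. $\mathbb{Z}^n$). It is strictly concave if $\phi(x)=\min_{\sigma\in\Sigma(n)}\langle m_\sigma,x\rangle$ for all $x$ and, for every $\sigma\in\Sigma(n)$, $\phi(x)=\langle m_\sigma,x\rangle$ if and only if $x\in\sigma$. Set $P_{r\phi}=\{m\in\mathbb{R}^n:\langle m,u_\rho\rangle\ge r\phi(u_\rho)\ \forall\rho\in\Sigma(1)\}$. For $m\in\mathbb{Z}^n$ let $\chi^m(z)=z_1^{m^{(1)}}\cdots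 z_n^{m^{(n)}}$ on $(\mathbb{C}^\times)^n$, and $$\theta_{r\phi}=-\frac{i}{2}\sum_{k=1}^n\frac{\sum_{m\in P_{r\phi}\cap\mathbb{Z}^n}m^{(k)}|\chi^m|^2}{\sum_{m\in P_{r\phi}\cap\mathbb{Z}^n}|\chi^m|^2}\left(\frac{dz_k}{z_k}-\frac{d\overline{z}_k}{\overline{z}_k}\right),\quad \mu_{r\phi}=\frac{\sum_{m\in P_{r\phi}\cap\mathbb{Z}^n}|\chi^m|^2\,m}{\sum_{m\in P_{r\phi}\cap\mathbb{Z}^n}|\chi^m|^2}.$$ The form $\omega_{r\phi}=d\theta_{r\phi}$ is symplectic. The map $\mu_{r\phi}:(\mathbb{C}^\times)^n\to\mathbb{R}^n$ has image $\operatorname{int}(P_{r\phi})$ and its fibers over interior points are Lagrangian tori on which $(S^1)^n\subset(\mathbb{C}^\times)^n$ acts freely and transitively. *)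

(* Defs.v *)
From HB Require Import structures.
From mathcomp Require Import all_boot all_order all_algebra.
From mathcomp Require Import all_classical all_reals all_analysis.
From mathcomp Require Import complex.

Set Implicit Arguments.
Unset Strict Implicit.
Unset Printing Implicit Defensive.

Import Order.TTheory GRing.Theory Num.Theory.
Import numFieldNormedType.Exports.

Local Open Scope classical_set_scope.
Local Open Scope complex_scope.
Local Open Scope ring_scope.

Section Fans.
Context {R : realType} {n : nat}.
Implicit Types (sigma tau rho : set 'rV[R]_n) (Sigma : set (set 'rV[R]_n)).

Definition dotp (m x : 'rV[R]_n) : R := \sum_k m 0 k * x 0 k.

Definition lattice_vec (u : 'rV[int]_n) : 'rV[R]_n := map_mx intr u.

(* The cone is generated by the rows of B. *)
Definition rational_polyhedral sigma : Prop :=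
  exists (k : nat) (B : 'M[int]_(k, n)),
    sigma = [set x | exists c : 'rV[R]_k,
                       (forall i, 0 <= c 0 i) /\ x = c *m map_mx intr B].

Definition strongly_convex sigma : Prop :=
  forall x, sigma x -> sigma (- x) -> x = 0.

Definition face tau sigma : Prop :=
  exists m : 'rV[R]_n, (forall x, sigma x -> 0 <= dotp m x) /\
    tau = [set x | sigma x /\ dotp m x = 0].

Definition complete_fan Sigma : Prop :=
  [/\ finite_set Sigma,
      forall sigma, Sigma sigma ->
        rational_polyhedral sigma /\ strongly_convex sigma,
      forall sigma tau, Sigma sigma -> face tau sigma -> Sigma tau,
      forall sigma tau, Sigma sigma -> Sigma tau ->
        [/\ Sigma (sigma `&` tau), face (sigma `&` tau) sigma
          & face (sigma `&` tau) tau]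
    & \bigcup_(sigma in Sigma) sigma = setT].

(* The dimension of a cone is that of its linear span W. *)
Definition cone_dim sigma (k : nat) : Prop :=
  exists W : {vspace 'rV[R]_n},
    [/\ \dim W = k, forall x, sigma x -> x \in W
      & forall U : {vspace 'rV[R]_n},
          (forall x, sigma x -> x \in U) -> (W <= U)%VS].

Definition cones Sigma (k : nat) : set (set 'rV[R]_n) :=
  [set sigma | Sigma sigma /\ cone_dim sigma k].

(* Total, by choice; it is the unique primitive lattice vector of rho
   whenever rho is a rational ray. *)
Definition ray_gen rho : 'rV[int]_n :=
  xget 0 [set u | rho (lattice_vec u) /\ \big[gcdn/0%N]_(k < n) absz (u 0 k) = 1%N].

Definition linear_with sigma (phi : 'rV[R]_n -> R) (m : 'rV[R]_n) : Prop :=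
  forall x, sigma x -> phi x = dotp m x.

Definition PL Sigma (phi : 'rV[R]_n -> R) : Prop :=
  continuous phi /\
  forall sigma, Sigma sigma -> exists m, linear_with sigma phi m.

(* Total, by choice; it is the unique m_sigma with phi = <m_sigma, .> on sigma
   when phi is PL and sigma is full-dimensional. *)
Definition slope (phi : 'rV[R]_n -> R) sigma : 'rV[R]_n :=
  xget 0 [set m | linear_with sigma phi m].

Definition rational_PL Sigma (phi : 'rV[R]_n -> R) : Prop :=
  PL Sigma phi /\
  forall sigma, cones Sigma n sigma ->
    exists q : 'rV[rat]_n, slope phi sigma = map_mx ratr q.

Definition integral_PL Sigma (phi : 'rV[R]_n -> R) : Prop :=
  PL Sigma phi /\
  forall sigma, cones Sigma n sigma ->
    exists u : 'rV[int]_n, slope phi sigma = lattice_vec u.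

Definition strictly_concave Sigma (phi : 'rV[R]_n -> R) : Prop :=
  (forall x,
     (forall sigma, cones Sigma n sigma -> phi x <= dotp (slope phi sigma) x) /\
     (exists2 sigma, cones Sigma n sigma & phi x = dotp (slope phi sigma) x)) /\
  (forall sigma, cones Sigma n sigma ->
     forall x, phi x = dotp (slope phi sigma) x <-> sigma x).

Definition polytope Sigma (psi : 'rV[R]_n -> R) : set 'rV[R]_n :=
  [set m | forall rho, cones Sigma 1 rho ->
     psi (lattice_vec (ray_gen rho)) <= dotp m (lattice_vec (ray_gen rho))].

Definition lattice_points (P : set 'rV[R]_n) : set 'rV[int]_n :=
  [set m | P (lattice_vec m)].

End Fans.

Section MomentMap.
Context {R : realType} {n : nat}.
Implicit Types (P : set 'rV[R]_n) (z v : 'rV[R[i]]_n) (m : 'rV[int]_n).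

Definition torus : set 'rV[R[i]]_n := [set z | forall k, z 0 k != 0].

Definition chi m z : R[i] := \prod_k z 0 k ^ m 0 k.

Definition abs_chi2 m z : R := Normc.normc (chi m z) ^+ 2.

Definition mu P z : 'rV[R]_n :=
  (\sum_(m \in lattice_points P) abs_chi2 m z)^-1 *:
  \sum_(m \in lattice_points P) (abs_chi2 m z *: lattice_vec m).

(* The value at z of the one-form on the tangent vector v, with
   dz_k(v) = v_k and d\bar{z}_k(v) = \bar{v_k}. *)
Definition theta P z v : R[i] :=
  - ('i%C / 2%:R) *
  \sum_k ((\sum_(m \in lattice_points P) (m 0 k)%:~R * abs_chi2 m z) /
          (\sum_(m \in lattice_points P) abs_chi2 m z))%:C *
         (v 0 k / z 0 k - (v 0 k)^*%C / (z 0 k)^*%C).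

End MomentMap.

Section Smooth.
Context {R : realType}.

Fixpoint iter_derive {V W : normedModType R} (vs : seq V) (f : V -> W) : V -> W :=
  if vs is v :: vs' then 'D_v (iter_derive vs' f) else f.

(* C^\infty on the open set U. *)
Definition smooth_on {V W : normedModType R} (U : set V) (f : V -> W) : Prop :=
  forall (vs : seq V) (x : V), U x -> differentiable (iter_derive vs f) x.

(* v is the velocity at p of a smooth curve contained in L. *)
Definition tangent {V : normedModType R} (L : set V) (p v : V) : Prop :=
  exists gamma : R -> V,
    [/\ smooth_on (V := R^o) setT gamma, forall t, L (gamma t),
        gamma 0 = p & derive1 gamma 0 = v].

(* The restriction to L of the one-form alpha is df for some smooth
   f : L -> R.  Smoothness on L means having, around each point of L, a smooth
   local extension F to the ambient space; for v tangent to L at p, df_p(v) is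
   then dF_p(v). Only the values of f on L matter. *)
Definition exact_on {V : normedModType R} (L : set V) (alpha : V -> V -> R[i]) :
    Prop :=
  exists f : V -> R, forall p, L p ->
    exists (U : set V) (F : V -> R),
      [/\ open U, U p, smooth_on (W := R^o) U F,
          forall q, U q -> L q -> F q = f q
        & forall v, tangent L p v -> alpha p v = ('d F p v)%:C].

End Smooth.

(* C^n is not a normed space over R in the library: its smooth structure is the
   one of R^n * R^n, through (x, y) |-> x + i y. *)
Definition to_complex {R : realType} {n : nat} (p : 'rV[R]_n * 'rV[R]_n) :
  'rV[R[i]]_n := \row_k (p.1 0 k +i* p.2 0 k).

Definition mu_fiber {R : realType} {n : nat} (P : set 'rV[R]_n) (c : 'rV[R]_n) :
  set ('rV[R]_n * 'rV[R]_n) :=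
  [set p | torus (to_complex p) /\ mu P (to_complex p) = c].

Definition theta_form {R : realType} {n : nat} (P : set 'rV[R]_n)
  (p v : 'rV[R]_n * 'rV[R]_n) : R[i] := theta P (to_complex p) (to_complex v).

(* Main.v *)
(** The coefficients of theta in the coframe (dz_k/z_k - d\bar z_k/\bar z_k) are, up
    to the factor -i/2, the coordinates of the moment map mu.  Hence theta vanishes
    identically along mu^{-1}(0), where it is the differential of 0. *)

Require Import Defs.
From HB Require Import structures.
From mathcomp Require Import all_boot all_order all_algebra.
From mathcomp Require Import all_classical all_reals all_analysis.
From mathcomp Require Import complex.

Set Implicit Arguments.
Unset Strict Implicit.
Unset Printing Implicit Defensive.

Import Order.TTheory GRing.Theory Num.Theory.
Import numFieldNormedType.Exports.

Local Open Scope classical_set_scope.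
Local Open Scope ring_scope.

(** Makes the support of the weights the whole set of lattice points, which decides whether their
    sum takes its default value. *)
Lemma abs_chi2_neq0 (R : realType) (n : nat) (m : 'rV[int]_n)
    (z : 'rV[R[i]]_n) : torus z -> abs_chi2 m z != 0.
Proof.
move=> tz; rewrite /abs_chi2 expf_neq0 //.
have : chi m z != 0.
  by apply/prodf_neq0 => k _; rewrite expfz_neq0 //; exact: tz.
by apply: contraNneq => /Normc.eq0_normc ->.
Qed.

(* The mean of the [k]-th coordinates is literally the coefficient of [theta].
   If there were infinitely many lattice points, the finite-support sum of the
   nonzero weights would be the junk value 0, and both sides would vanish. *)
Lemma mu_coord (R : realType) (n : nat) (P : set 'rV[R]_n) (z : 'rV[R[i]]_n)
    (k : 'I_n) : torus z ->
  mu P z 0 k =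
  (\sum_(m \in lattice_points P) (m 0 k)%:~R * abs_chi2 m z) /
  (\sum_(m \in lattice_points P) abs_chi2 m z).
Proof.
move=> tz; rewrite /mu mxE [RHS]mulrC.
have [finP|infP] := pselect (finite_set (lattice_points P)).
  congr (_ * _); rewrite !fsbig_finite//= summxE.
  by apply: eq_bigr => m _; rewrite !mxE mulrC.
rewrite [X in X^-1](_ : _ = 0) ?invr0 ?mul0r//.
apply: fsbig_dflt => //.
rewrite (_ : _ `&` _ = lattice_points P)//.
by apply/seteqP; split=> [m []//|m Pm]; split=> //=; apply/eqP/abs_chi2_neq0.
Qed.

Lemma theta_mu (R : realType) (n : nat) (P : set 'rV[R]_n)
    (z v : 'rV[R[i]]_n) : torus z ->
  theta P z v = - ('i%C / 2%:R) *
    \sum_k (mu P z 0 k)%:C%C * (v 0 k / z 0 k - (v 0 k)^*%C / (z 0 k)^*%C).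
Proof.
by move=> tz; congr (_ * _); apply: eq_bigr => k _; rewrite mu_coord.
Qed.

Lemma smooth_on_cst (R : realType) (V W : normedModType R) (U : set V) (c : W) :
  smooth_on U (cst c : V -> W).
Proof.
move=> vs x _.
(* The constant is existentially quantified because the first derivative turns [c] into 0. *)
have [d ->] : exists d : W, iter_derive vs (cst c : V -> W) = cst d.
  elim: vs => [|v vs [d IHd]] /=; first by exists c.
  by exists 0; rewrite IHd; apply/funext => y; exact: derive_cst.
exact: differentiable_cst.
Qed.

Theorem corollary6p9 (R : realType) (n : nat) (hn : (0 < n)%N)
    (Sigma : set (set 'rV[R]_n)) (hSigma : complete_fan Sigma)
    (phi : 'rV[R]_n -> R) (hrat : rational_PL Sigma phi)
    (hconc : strictly_concave Sigma phi)
    (r : nat) (hr : (0 < r)%N)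
    (hint : integral_PL Sigma (fun x => r%:R * phi x))
    (h0 : interior (polytope Sigma (fun x => r%:R * phi x)) 0) :
  exact_on (mu_fiber (polytope Sigma (fun x => r%:R * phi x)) 0)
           (theta_form (polytope Sigma (fun x => r%:R * phi x))).
Proof.
(* The zero function on the whole space serves as smooth extension of the primitive 0 around every
   point of the fiber. *)
exists (fun=> 0) => p [tp mup]; exists setT, (cst 0); split=> //.
- exact: openT.
- exact: smooth_on_cst.
- move=> v _; rewrite /theta_form theta_mu// mup diff_cst big1 ?mulr0//.
  by move=> k _; rewrite mxE mul0r.
Qed.
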